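(* Let $m,N\ge 1$ and let $\mathbf M\in[-1,1]^{m\times N}$ be a feature matrix. There is a constant $C$, depending only on $\mathbf M$, such that for every $\varepsilon>0$ AdaBoost run on $\mathbf M$ reaches within $\varepsilon$ of the optimal loss in at most $C/\varepsilon$ rounds; that is, for every run of AdaBoost there is a $t\le C/\varepsilon$ with $L(\lambda^t)\le \inf_{\lambda\in\mathbb R^N}L(\lambda)+\varepsilon$.
   Context: Feature matrix: $\mathbf M\in[-1,1]^{m\times N}$, with rows indexed by training examples $i=1,\dots,m$ and columns by weak hypotheses $j=1,\dots,N$ (it arises as $M_{ij}=y_i h_j(x_i)$ with labels $y_i\in\{-1,+1\}$ and weak hypotheses $h_j$ with values in $[-1,+1]$). The exponential loss of $\lambda\in\mathbb R^N$ is $L(\lambda)=\frac1m\sum_{i=1}^m e^{-(\mathbf M\lambda)_i}$. AdaBoost: start with $\lambda^0=0$. In round $t=1,2,\dots$, let $D_t(i)=e^{-(\mathbf M\lambda^{t-1})_i}/\sum_{k=1}^m e^{-(\mathbf M\lambda^{t-1})_k}$, choose a column $j_t$ maximizing $\left|\sum_i D_t(i)M_{ij}\right|$ over $j$ (ties broken arbitrarily), put $r_t=\sum_i D_t(i)M_{ij_t}$ and $\alpha_t=\frac12\ln\frac{1+r_t}{1-r_t}$, and set $\lambda^t=\lambda^{t-1}+\alpha_t\mathbf e_{j_t}$, where $\mathbf e_j$ is the $j$-th standard basis vector. If $|r_t|=1$, the step is infinite; the loss after round $t$ is then taken to be its limiting value $0$ and the algorithm stops (all later losses are $0$). The loss is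 non-increasing in $t$. *)

(* Defs.v *)
From HB Require Import structures.
From mathcomp Require Import all_boot all_order all_algebra.
From mathcomp Require Import all_classical all_reals all_analysis.

Set Implicit Arguments.
Unset Strict Implicit.
Unset Printing Implicit Defensive.

Import Order.TTheory GRing.Theory Num.Theory.
Local Open Scope ring_scope.

Definition exp_loss (R : realType) (m N : nat) (M : 'M[R]_(m, N))
    (l : 'cV[R]_N) : R :=
  m%:R^-1 * \sum_(i < m) expR (- (M *m l) i 0).

Definition example_weight (R : realType) (m N : nat) (M : 'M[R]_(m, N))
    (l : 'cV[R]_N) (i : 'I_m) : R :=
  expR (- (M *m l) i 0) / \sum_(k < m) expR (- (M *m l) k 0).

Definition edge (R : realType) (m N : nat) (M : 'M[R]_(m, N))
    (l : 'cV[R]_N) (j : 'I_N) : R :=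
  \sum_(i < m) example_weight M l i * M i j.

Definition step_size (R : realType) (r : R) : R :=
  2^-1 * ln ((1 + r) / (1 - r)).

(* A state is [Some l] for a finite weight vector [l], and [None] once an
   infinite step (|r| = 1) has been taken; the algorithm then stays at [None].
   The column [j] is existentially quantified: ties are broken arbitrarily. *)
Definition adaboost_step (R : realType) (m N : nat) (M : 'M[R]_(m, N))
    (s s' : option 'cV[R]_N) : Prop :=
  if s is Some l then
    exists2 j : 'I_N, (forall k : 'I_N, `|edge M l k| <= `|edge M l j|) &
      s' = if `|edge M l j| == 1 then None
           else Some (l + step_size (edge M l j) *: delta_mx j 0)
  else s' = None.

Definition adaboost_run (R : realType) (m N : nat) (M : 'M[R]_(m, N))
    (s : nat -> option 'cV[R]_N) : Prop :=
  s 0%N = Some 0 /\ forall t : nat, adaboost_step M (s t) (s t.+1).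

(* The loss after an infinite step is its limiting value 0. *)
Definition state_loss (R : realType) (m N : nat) (M : 'M[R]_(m, N))
    (s : option 'cV[R]_N) : R :=
  if s is Some l then exp_loss M l else 0.

(* Main.v *)
Require Import Defs.
From HB Require Import structures.
From mathcomp Require Import all_boot all_order all_algebra.
From mathcomp Require Import all_classical all_reals all_analysis.
From mathcomp Require Import ring lra.

(** Write [Linf] for the infimum of the loss [L], [D = L - Linf] for the excess
    of the current iterate and [r] for its largest edge.  A coordinate step
    multiplies [L] by at most [1 - r^2/2] (lemma [exp_loss_step]), so a bound
    [D <= B * L * r] (lemma [edge_lower_bound]) turns, since [L <= 1] along a
    run, into the recursion [D' <= D - D^2/K] with [K = 2 B^2 + 1].  Such a
    recursion forces [(t + 1) D_t <= K], which is the claimed rate.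

    The bound on the edge is where the difficulty lies, because [L] need not
    have a minimizer.  By convexity it follows from the existence of a constant
    [B] such that every [l] with [L l <= 1] admits a displacement [d] of
    1-norm at most [B] that halves the excess (lemma [halving_direction]): the
    decrease [D/2] is at most the pairing of [d] with the negative gradient,
    whose entries are [L] times the edges.

    To find [d], the examples are split into two classes (lemma
    [row_dichotomy]).  On the sublevel set [L <= 1] all margins are at least
    [- m].  On the polyhedron cut out by these inequalities, the rows of [F] have
    margins bounded above as well, and every other row has arbitrarily large
    margins.
    Adding up witnesses of this and removing the bounded part seen by [F] gives
    a single direction [eta] whose margin vanishes on [F] and is at least 1
    off [F].  Thus a fixed multiple of [eta] scales down the losses off [F]
    without touching those in [F], while on [F] the margins of [l] can be
    replaced by those of a nearly optimal vector by a bounded displacement, as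
    both lie in a bounded part of the range of the rows of [F].  Off [F] that
    displacement changes the margins by a bounded amount, for which a further
    multiple of [eta] compensates. *)

Set Implicit Arguments.
Unset Strict Implicit.
Unset Printing Implicit Defensive.

Import Order.TTheory GRing.Theory Num.Theory.
Local Open Scope classical_set_scope.
Local Open Scope ring_scope.

(** * Bounded and unbounded margins *)

Lemma mulmx_entry_bound (R : realType) (p q : nat) (P : 'M[R]_(p, q)) :
  exists2 k : R, 0 <= k & forall (v : 'cV[R]_q) (a : R),
    0 <= a -> (forall i, `|v i 0| <= a) -> forall j, `|(P *m v) j 0| <= k * a.
Proof.
exists (\sum_j \sum_i `|P j i|).
  by apply: sumr_ge0 => j _; apply: sumr_ge0.
move=> v a a0 va j; rewrite mxE.
apply: (le_trans (ler_norm_sum _ _ _)).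
apply: (@le_trans _ _ (\sum_i `|P j i| * a)).
  by apply: ler_sum => i _; rewrite normrM ler_wpM2l.
rewrite -mulr_suml ler_wpM2r //.
rewrite (bigD1 j) //= lerDl; apply: sumr_ge0 => k _; exact: sumr_ge0.
Qed.

(** Any vector of margins on [F] that is attained at all is attained by a
    vector of comparable size: a generalized inverse of the matrix with the rows
    outside [F] zeroed out is one fixed linear map that finds it. *)
Lemma restricted_image_lift (R : realType) (m N : nat) (M : 'M[R]_(m, N))
    (F : {set 'I_m}) :
  exists2 k : R, 0 <= k & forall (v : 'cV[R]_N) (a : R), 0 <= a ->
    (forall i, i \in F -> `|(M *m v) i 0| <= a) ->
    exists2 d : 'cV[R]_N, forall j, `|d j 0| <= k * a &
      forall i, i \in F -> (M *m d) i 0 = (M *m v) i 0.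
Proof.
pose MF : 'M[R]_(m, N) := \matrix_(i, j) (if i \in F then M i j else 0).
have MFE (l : 'cV[R]_N) i :
    (MF *m l) i 0 = if i \in F then (M *m l) i 0 else 0.
  rewrite !mxE; case: ifP => iF; last first.
    by rewrite big1 // => j _; rewrite mxE iF mul0r.
  by apply: eq_bigr => j _; rewrite mxE iF.
have [P PK] : exists P : 'M[R]_(N, m), MF *m P *m MF = MF.
  by exists (pinvmx MF); apply: mulmxKpV.
have [k k_ge0 kP] := mulmx_entry_bound P.
exists k => // v a a0 va; exists (P *m (MF *m v)).
  by apply: kP => // i; rewrite MFE; case: ifP => iF; rewrite ?normr0 // va.
move=> i iF; have E (l : 'cV[R]_N) : (M *m l) i 0 = (MF *m l) i 0.
  by rewrite MFE iF.
by rewrite !E !mulmxA PK.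
Qed.

(** Here [F] is the set of rows whose margin is bounded above on the polyhedron
    where all margins are at least [- b].  For each row outside [F] choose a
    point of the polyhedron where its margin exceeds a large threshold [T].  The
    sum of these points has large margins off [F] and, whatever [T] is, bounded
    margins on [F]; subtracting a lift of the latter gives [eta].  The size of
    the lift does not depend on [T], so [T] can be chosen to absorb it. *)
Lemma row_dichotomy (R : realType) (m N : nat) (M : 'M[R]_(m, N)) (b : R) :
  0 <= b ->
  exists (F : {set 'I_m}) (A : R) (eta : 'cV[R]_N),
  [/\ 0 <= A,
      forall l : 'cV[R]_N, (forall k, - b <= (M *m l) k 0) ->
        forall i, i \in F -> `|(M *m l) i 0| <= A,
      forall i, i \in F -> (M *m eta) i 0 = 0 &
      forall i, i \notin F -> 1 <= (M *m eta) i 0].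
Proof.
move=> b0.
pose bounded i a := forall l : 'cV[R]_N,
  (forall k, - b <= (M *m l) k 0) -> (M *m l) i 0 <= a.
pose F := [set i | `[< exists a, bounded i a >] ]%SET.
have /choice [f fP] (i : 'I_m) : exists a, i \in F -> bounded i a.
  case: (boolP (i \in F)) => [|_]; last by exists 0.
  by rewrite inE => /asboolP [a ai]; exists a.
pose A := b + \sum_i `|f i|.
have A0 : 0 <= A by rewrite addr_ge0 // sumr_ge0.
have FA (l : 'cV[R]_N) : (forall k, - b <= (M *m l) k 0) ->
    forall i, i \in F -> `|(M *m l) i 0| <= A.
  move=> lb i iF; have /= u := fP _ iF _ lb; have /= lo := lb i.
  have fi : `|f i| <= \sum_i `|f i|.
    by rewrite (bigD1 i) //= lerDl sumr_ge0.
  have s0 : 0 <= \sum_i `|f i| by rewrite sumr_ge0.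
  have := ler_norm (f i).
  by rewrite ler_norml /A => ?; apply/andP; split; lra.
have [k1 k1_ge0 k1P] := restricted_image_lift M F.
have [k2 k2_ge0 k2P] := mulmx_entry_bound M.
pose T := 1 + m%:R * b + k2 * (k1 * (m%:R * A)).
have /choice [g gP] (i : 'I_m) : exists l : 'cV[R]_N,
    (forall k, - b <= (M *m l) k 0) /\ (i \notin F -> T <= (M *m l) i 0).
  case: (boolP (i \in F)) => [_|].
    by exists 0; split=> // k; rewrite mulmx0 mxE oppr_le0.
  rewrite inE => /asboolPn /forallNP /(_ T) /existsNP [l /not_implyP [lb lT]].
  by exists l; split=> // _; apply/ltW; rewrite ltNge; apply/negP.
pose eta0 := \sum_i g i.
have eta0E k : (M *m eta0) k 0 = \sum_i (M *m g i) k 0.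
  by rewrite mulmx_sumr summxE.
have [d dk dF] : exists2 d : 'cV[R]_N,
    forall j, `|d j 0| <= k1 * (m%:R * A) &
    forall i, i \in F -> (M *m d) i 0 = (M *m eta0) i 0.
  apply: k1P => [|j jF]; first by rewrite mulr_ge0.
  rewrite eta0E; apply: (le_trans (ler_norm_sum _ _ _)).
  apply: (@le_trans _ _ (\sum_(i < m) A)).
    by apply: ler_sum => k _; apply: FA => //; case: (gP k).
  by rewrite sumr_const card_ord mulr_natl.
have subE i : (M *m (eta0 - d)) i 0 = (M *m eta0) i 0 - (M *m d) i 0.
  by rewrite mulmxBr [LHS]mxE [X in _ + X]mxE.
exists F, A, (eta0 - d); split=> // i iF; rewrite subE.
  by rewrite dF // subrr.
have := k2P _ _ _ dk i; rewrite !mulr_ge0 // => /(_ isT).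
rewrite ler_norml => /andP [_ u].
have v : T - m%:R * b <= (M *m eta0) i 0.
  rewrite eta0E (bigD1 i) //=; apply: lerD; first by case: (gP i) => _; apply.
  apply: (@le_trans _ _ (\sum_(k < m | k != i) - b)).
    rewrite sumr_const mulNrn lerN2 mulr_natl ler_wpMn2l //.
    by rewrite (leq_trans (max_card _)) ?card_ord.
  by apply: ler_sum => k _; case: (gP k).
by move: u v; rewrite /T; lra.
Qed.

(** * The exponential loss *)

Lemma sublevel_rows (R : realType) (m N : nat) (M : 'M[R]_(m, N))
    (l : 'cV[R]_N) :
  (0 < m)%N -> exp_loss M l <= 1 -> forall k, - m%:R <= (M *m l) k 0.
Proof.
move=> hm; rewrite /exp_loss ler_pdivrMl ?ltr0n // mulr1 => h k.
have : expR (- (M *m l) k 0) <= m%:R.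
  by apply: le_trans h; rewrite (bigD1 k) //= lerDl sumr_ge0.
by have := expR_ge1Dx (- (M *m l) k 0); lra.
Qed.

Section Loss.
Context (R : realType) (m N : nat) (M : 'M[R]_(m, N)) (hm : (0 < m)%N).

Lemma exp_loss_ge0 l : 0 <= exp_loss M l.
Proof. by rewrite mulr_ge0 ?invr_ge0 // sumr_ge0. Qed.

Lemma exp_loss0 : exp_loss M 0 = 1.
Proof.
rewrite /exp_loss (eq_bigr (fun=> 1)) => [|i _].
  by rewrite sumr_const card_ord mulVf // pnatr_eq0 -lt0n.
by rewrite mulmx0 mxE oppr0 expR0.
Qed.

Lemma exp_loss_has_inf : has_inf (range (exp_loss M)).
Proof.
split; first by exists (exp_loss M 0), 0.
by exists 0 => _ [l _ <-]; apply: exp_loss_ge0.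
Qed.

Lemma inf_exp_loss_le l : inf (range (exp_loss M)) <= exp_loss M l.
Proof. by apply: ge_inf; [case: exp_loss_has_inf | exists l]. Qed.

Lemma inf_exp_loss_ge0 : 0 <= inf (range (exp_loss M)).
Proof.
apply: lb_le_inf; first by case: exp_loss_has_inf.
by move=> _ [l _ <-]; apply: exp_loss_ge0.
Qed.

(** Multiplying by the loss cancels the normalization of the example weights. *)
Lemma exp_loss_mean l (f : 'I_m -> R) :
  exp_loss M l * \sum_i example_weight M l i * f i =
  m%:R^-1 * \sum_i expR (- (M *m l) i 0) * f i.
Proof.
rewrite /exp_loss -mulrA; congr (_ * _).
have W0 : \sum_(k < m) expR (- (M *m l) k 0) != 0.
  by rewrite gt_eqF // (bigD1 (Ordinal hm)) //= ltr_pwDl ?expR_gt0 ?sumr_ge0.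
rewrite mulr_sumr; apply: eq_bigr => i _.
by rewrite /example_weight; field.
Qed.

Lemma sum_example_weight l : \sum_i example_weight M l i = 1.
Proof.
rewrite -mulr_suml mulfV // gt_eqF // (bigD1 (Ordinal hm)) //=.
by rewrite ltr_pwDl ?expR_gt0 ?sumr_ge0.
Qed.

Lemma norm_edge_le1 l j :
  (forall i, -1 <= M i j <= 1) -> `|edge M l j| <= 1.
Proof.
move=> hM; rewrite /edge -(sum_example_weight l).
apply: (le_trans (ler_norm_sum _ _ _)); apply: ler_sum => i _.
have w0 : 0 <= example_weight M l i.
  by rewrite mulr_ge0 ?expR_ge0 // invr_ge0 sumr_ge0.
by rewrite normrM ger0_norm // ler_piMr // ler_norml.
Qed.

(** The tangent plane of the convex loss lies below its graph; the gradient at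
    [l] has entries [- exp_loss M l * edge M l j]. *)
Lemma exp_loss_tangent l (d : 'cV[R]_N) :
  exp_loss M l - exp_loss M l * \sum_j edge M l j * d j 0 <=
  exp_loss M (l + d).
Proof.
have -> : \sum_j edge M l j * d j 0 =
    \sum_i example_weight M l i * (M *m d) i 0.
  under eq_bigr do rewrite mulr_suml.
  rewrite exchange_big; apply: eq_bigr => i _ /=.
  by rewrite mxE mulr_sumr; apply: eq_bigr => j _; rewrite mulrA.
rewrite exp_loss_mean /exp_loss -mulrBr ler_wpM2l ?invr_ge0 //.
rewrite -sumrB; apply: ler_sum => i _.
have -> : (M *m (l + d)) i 0 = (M *m l) i 0 + (M *m d) i 0.
  by rewrite mulmxDr mxE.
rewrite opprD expRD -{1}[expR (- (M *m l) i 0)]mulr1 -mulrBr.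
by rewrite ler_wpM2l ?expR_ge0 // expR_ge1Dx.
Qed.

(** For [x] in [-1, 1], the number [- a * x] is the convex combination of
    [- a] and [a] with weights [(1 + x) / 2] and [(1 - x) / 2]; convexity of
    the exponential and averaging over the example weights give the bound. *)
Lemma exp_loss_coordinate l j (a : R) :
  (forall i, -1 <= M i j <= 1) ->
  exp_loss M (l + a *: delta_mx j 0) <=
  exp_loss M l * ((1 + edge M l j) / 2 * expR (- a) +
                  (1 - edge M l j) / 2 * expR a).
Proof.
move=> hM.
have -> : (1 + edge M l j) / 2 * expR (- a) + (1 - edge M l j) / 2 * expR a =
  \sum_i example_weight M l i *
    ((1 + M i j) / 2 * expR (- a) + (1 - M i j) / 2 * expR a).
  transitivity ((expR (- a) + expR a) / 2 * \sum_i example_weight M l i +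
                (expR (- a) - expR a) / 2 * edge M l j).
    by rewrite sum_example_weight; field.
  by rewrite !mulr_sumr -big_split; apply: eq_bigr => i _ /=; field.
rewrite exp_loss_mean /exp_loss ler_wpM2l ?invr_ge0 //.
apply: ler_sum => i _.
have -> : (M *m (l + a *: delta_mx j 0)) i 0 = (M *m l) i 0 + a * M i j.
  rewrite mulmxDr -scalemxAr mxE; congr (_ + _).
  by rewrite mxE -colE mxE.
rewrite opprD expRD ler_wpM2l ?expR_ge0 //.
have /andP [lo hi] := hM i; set x := M i j in lo hi *.
set z := - (a * x).
(* Jensen: average the tangent at [z] over the two end points. *)
have tangent y : expR z * (1 + (y - z)) <= expR y.
  have -> : expR y = expR z * expR (y - z) by rewrite -expRD addrC subrK.
  by rewrite ler_wpM2l ?expR_ge0 // expR_ge1Dx.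
have h1 : (1 + x) / 2 * (expR z * (1 + (- a - z))) <= (1 + x) / 2 * expR (- a).
  by apply: ler_wpM2l => //; lra.
have h2 : (1 - x) / 2 * (expR z * (1 + (a - z))) <= (1 - x) / 2 * expR a.
  by apply: ler_wpM2l => //; lra.
apply: le_trans (lerD h1 h2); rewrite le_eqVlt; apply/orP; left; apply/eqP.
by rewrite /z; field.
Qed.

(** The step size minimizes the bound of [exp_loss_coordinate]; the minimum
    is [Num.sqrt (1 - r ^+ 2)], which is at most [1 - r ^+ 2 / 2]. *)
Lemma exp_loss_step l j :
  (forall i, -1 <= M i j <= 1) -> `|edge M l j| < 1 ->
  exp_loss M (l + step_size (edge M l j) *: delta_mx j 0) <=
  exp_loss M l * (1 - edge M l j ^+ 2 / 2).
Proof.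
move=> hM; set r := edge M l j; rewrite ltr_norml => /andP [r1 r2].
apply: (le_trans (exp_loss_coordinate _ _ hM)); rewrite -/r.
rewrite ler_wpM2l ?exp_loss_ge0 //.
set a := step_size r; set x := expR a.
have x0 : 0 < x by apply: expR_gt0.
have xx : x * x = (1 + r) / (1 - r).
  rewrite -expRD /a /step_size -mulrDl.
  have -> : 2^-1 + 2^-1 = 1 :> R by lra.
  by rewrite mul1r lnK // posrE divr_gt0; lra.
have h : 1 + r = (1 - r) * x * x by rewrite -mulrA xx; field; lra.
rewrite expRN -/x.
have -> : (1 + r) / 2 / x + (1 - r) / 2 * x = (1 - r) * x.
  by rewrite {1}h; field; lra.
have s : ((1 - r) * x) ^+ 2 <= (1 - r ^+ 2 / 2) ^+ 2.
  have -> : ((1 - r) * x) ^+ 2 = (1 - r) * (1 + r) by rewrite h; ring.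
  by have := sqr_ge0 (r ^+ 2); lra.
rewrite -(ler_pXn2r (n := 2)) // nnegrE; last by nra.
by rewrite mulr_ge0 //; lra.
Qed.

(** * Progress towards the infimum *)

(** The displacement is [d0 + s *: eta], where [d0] gives the rows of [F] the
    margins of a vector [mu] whose excess is at most one eighth of that of [l],
    and [s *: eta] makes up for the effect of [d0] on the other rows and raises
    their margins by a further 7, dividing their losses by at least
    [1 + 7 <= expR 7].  The part of the loss outside [F] is at most twice the
    excess, because moving along [eta] by 1 already halves it.  In total the
    excess falls to at most [1/8 + 2/8] of its value. *)
Lemma halving_direction :
  exists2 B : R, 0 <= B & forall l : 'cV[R]_N, exp_loss M l <= 1 ->
    inf (range (exp_loss M)) < exp_loss M l ->
    exists2 d : 'cV[R]_N, \sum_j `|d j 0| <= B &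
      exp_loss M (l + d) - inf (range (exp_loss M)) <=
      (exp_loss M l - inf (range (exp_loss M))) / 2.
Proof.
have [F [A [eta [A0 FA etaF etaZ]]]] := row_dichotomy M (ler0n R m).
have [k1 k1_ge0 k1P] := restricted_image_lift M F.
have [k2 k2_ge0 k2P] := mulmx_entry_bound M.
set Linf := inf _.
pose c := k1 * (A + A); pose s := 7 + k2 * c.
have c_ge0 : 0 <= c by rewrite mulr_ge0 // addr_ge0.
have s_ge0 : 0 <= s by rewrite addr_ge0 // mulr_ge0.
exists (N%:R * c + s * \sum_j `|eta j 0|).
  by rewrite addr_ge0 // mulr_ge0 // sumr_ge0.
move=> l l1 lLinf.
pose D := exp_loss M l - Linf.
have D0 : 0 < D by rewrite subr_gt0.
have [_ [mu _ <-] muD] : exists2 y, range (exp_loss M) y & y < Linf + D / 8.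
  by apply: inf_adherent; [lra | apply: exp_loss_has_inf].
have mu1 : exp_loss M mu <= 1 by move: muD l1; rewrite /D; lra.
have [d0 d0c d0F] : exists2 d : 'cV[R]_N, forall j, `|d j 0| <= c &
    forall i, i \in F -> (M *m d) i 0 = (M *m (mu - l)) i 0.
  apply: k1P => [|i iF]; first exact: addr_ge0.
  have -> : (M *m (mu - l)) i 0 = (M *m mu) i 0 - (M *m l) i 0.
    by rewrite mulmxBr [LHS]mxE [X in _ + X]mxE.
  apply: (le_trans (ler_normB _ _)).
  by apply: lerD; apply: FA => //; apply: sublevel_rows.
pose LF (v : 'cV[R]_N) := m%:R^-1 * \sum_(i in F) expR (- (M *m v) i 0).
pose LZ (v : 'cV[R]_N) := m%:R^-1 * \sum_(i | i \notin F) expR (- (M *m v) i 0).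
have LE v : exp_loss M v = LF v + LZ v.
  by rewrite /exp_loss (bigID (mem F)) mulrDr.
have LZ_ge0 v : 0 <= LZ v by rewrite mulr_ge0 ?invr_ge0 // sumr_ge0.
have LF_eq v w : (forall i, i \in F -> (M *m v) i 0 = (M *m w) i 0) ->
    LF v = LF w.
  by move=> vw; congr (_ * _); apply: eq_bigr => i iF; rewrite vw.
have LZ_le (v w : 'cV[R]_N) (x : R) : 0 <= x ->
    (forall i, i \notin F -> (M *m w) i 0 + x <= (M *m v) i 0) ->
    LZ v * (1 + x) <= LZ w.
  move=> x0 vw; rewrite /LZ -mulrA ler_wpM2l ?invr_ge0 // mulr_suml.
  apply: ler_sum => i /vw h.
  apply: (@le_trans _ _ (expR (- (M *m v) i 0) * expR x)).
    by rewrite ler_wpM2l ?expR_ge0 // expR_ge1Dx.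
  by rewrite -expRD ler_expR; lra.
have addE (v w : 'cV[R]_N) i :
    (M *m (v + w)) i 0 = (M *m v) i 0 + (M *m w) i 0.
  by rewrite mulmxDr [LHS]mxE.
have scaleE (x : R) (v : 'cV[R]_N) i : (M *m (x *: v)) i 0 = x * (M *m v) i 0.
  by rewrite -scalemxAr [LHS]mxE.
have LZD : LZ l <= 2 * D.
  have F1 : LF (l + eta) = LF l.
    by apply: LF_eq => i iF; rewrite addE etaF // addr0.
  have Z1 : LZ (l + eta) * (1 + 1) <= LZ l.
    by apply: LZ_le => // i iF; rewrite addE lerD2l etaZ.
  have := inf_exp_loss_le (l + eta); rewrite -/Linf /D !LE F1.
  by move: Z1; lra.
exists (d0 + s *: eta).
  apply: (@le_trans _ _ (\sum_(j < N) (c + s * `|eta j 0|))).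
    apply: ler_sum => j _; rewrite [X in `|X|]mxE [X in _ + X]mxE.
    apply: (le_trans (ler_normD _ _)); rewrite normrM (ger0_norm s_ge0).
    by rewrite lerD2r.
  by rewrite big_split /= sumr_const card_ord mulr_natl mulr_sumr.
have F1 : LF (l + (d0 + s *: eta)) = LF mu.
  apply: LF_eq => i iF.
  by rewrite !addE scaleE etaF // mulr0 addr0 d0F // -addE addrC subrK.
have Z1 : LZ (l + (d0 + s *: eta)) * (1 + 7) <= LZ l.
  apply: LZ_le => // i iF; rewrite !addE scaleE lerD2l.
  have := k2P _ _ c_ge0 d0c i; rewrite ler_norml => /andP [u _].
  have := ler_wpM2l s_ge0 (etaZ i iF); rewrite mulr1.
  by move: u; rewrite /s; lra.
have := LZ_ge0 mu; move: muD; rewrite -/D !LE F1.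
by move: Z1 LZD D0; lra.
Qed.

(** Compare the tangent plane at [l] with the value of the loss after the
    displacement of [halving_direction]. *)
Lemma edge_lower_bound :
  exists2 B : R, 0 <= B & forall (l : 'cV[R]_N) (r : R),
    exp_loss M l <= 1 -> 0 <= r -> (forall k, `|edge M l k| <= r) ->
    exp_loss M l - inf (range (exp_loss M)) <= B * (exp_loss M l * r).
Proof.
have [B B0 BP] := halving_direction.
exists (2 * B); first by rewrite mulr_ge0.
move=> l r l1 r0 er; set Linf := inf _.
have L0 := exp_loss_ge0 l.
have [lLinf|lLinf] := ltP Linf (exp_loss M l); last first.
  apply: (@le_trans _ _ 0); first by rewrite subr_le0.
  exact: (mulr_ge0 (mulr_ge0 (ler0n R 2) B0) (mulr_ge0 L0 r0)).
have [d dB dhalf] := BP l l1 lLinf.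
have := exp_loss_tangent l d; set S := \sum_j _ => tan.
have SB : S <= r * B.
  apply: (@le_trans _ _ (\sum_j r * `|d j 0|)).
    apply: ler_sum => j _; apply: (le_trans (ler_norm _)).
    by rewrite normrM ler_wpM2r.
  by rewrite -mulr_sumr ler_wpM2l.
have := ler_wpM2l L0 SB; move: tan dhalf; rewrite -/Linf.
by lra.
Qed.

End Loss.

(** If [x <= K], it suffices that [(n + 1) * x * (K - x) <= K ^+ 2], which holds
    because [(n + 1) * x <= K + x] and [(K + x) * (K - x) <= K ^+ 2].
    If [K < x], then [y] is not positive. *)
Lemma harmonic_decrease (R : realFieldType) (K n x y : R) :
  0 < K -> 0 <= n -> 0 <= x -> n * x <= K -> K * y <= x * (K - x) ->
  (n + 1) * y <= K.
Proof.
move=> K0 n0 x0 nx Ky; rewrite -(ler_pM2l K0) mulrCA.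
have [xK|Kx] := leP x K; last first.
  apply: (@le_trans _ _ 0); last by nra.
  rewrite mulr_ge0_le0 //; first by lra.
  by apply: (le_trans Ky); rewrite mulr_ge0_le0 //; lra.
have h1 : (n + 1) * (K * y) <= (n + 1) * (x * (K - x)).
  by rewrite ler_wpM2l //; lra.
apply: (le_trans h1).
have h2 : (n * x + x) * (K - x) <= (K + x) * (K - x).
  by rewrite ler_wpM2r ?lerD2r //; lra.
by have := sqr_ge0 x; move: h2; lra.
Qed.

Theorem theorem14 (R : realType) (m N : nat) (M : 'M[R]_(m, N))
    (hm : (0 < m)%N) (hN : (0 < N)%N)
    (hM : forall (i : 'I_m) (j : 'I_N), -1 <= M i j <= 1) :
  exists C : R, forall eps : R, 0 < eps ->
    forall s : nat -> option 'cV[R]_N, adaboost_run M s ->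
      exists t : nat, t%:R <= C / eps /\
        state_loss M (s t) <= inf (range (exp_loss M)) + eps.
Proof.
have [B B0 BP] := edge_lower_bound M hm.
set Linf := inf _.
(* The summand 1 covers [t = 0], where the excess is at most 1. *)
pose K := 2 * B ^+ 2 + 1.
have K1 : 1 <= K by rewrite lerDr mulr_ge0 // sqr_ge0.
have Linf0 : 0 <= Linf := inf_exp_loss_ge0 M.
exists K => eps eps0 s [s0 step].
(* The loss bound by 1 is what makes [edge_lower_bound] applicable. *)
have rate t : state_loss M (s t) <= 1 /\
    t.+1%:R * (state_loss M (s t) - Linf) <= K.
  elim: t => [|t [l1 IH]].
    by rewrite s0 /= exp_loss0 //; split=> //; rewrite mul1r; lra.
  (* Both ways of being stopped give loss 0, which is at most [Linf]. *)
  have stopped : (0 : R) <= 1 /\ t.+2%:R * (0 - Linf) <= K.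
    split=> //; apply: (@le_trans _ _ 0); last by lra.
    by rewrite sub0r mulrN oppr_le0 mulr_ge0.
  have := step t; case: (s t) l1 IH => [l|] /= l1 IH; last first.
    by move=> ->; exact: stopped.
  move=> [j jmax ->]; case: eqP => [_|] /=; first exact: stopped.
  move=> r1.
  have L0 := exp_loss_ge0 M l.
  have rlt1 : `|edge M l j| < 1.
    by rewrite lt_neqAle (norm_edge_le1 hm) // andbT; apply/eqP.
  have := exp_loss_step hm (fun i => hM i j) rlt1.
  have := BP l _ l1 (normr_ge0 _) jmax.
  rewrite -/Linf -[edge M l j ^+ 2]real_normK ?num_real //.
  have : Linf <= exp_loss M l := inf_exp_loss_le M l.
  have := normr_ge0 (edge M l j).
  move: (exp_loss M l) (exp_loss M (l + _)) (`|_|) L0 l1 IH => L L' r.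
  move=> L0 l1 IH r0 LinfL bnd decr.
  have L'L : L' <= L.
    by apply: (le_trans decr); rewrite ler_piMr //; have := sqr_ge0 r; lra.
  split; first exact: le_trans l1.
  set x := L - Linf in IH bnd.
  have x0 : 0 <= x by rewrite subr_ge0.
  have xx : x ^+ 2 <= K * (L * (r ^+ 2 / 2)).
    apply: (@le_trans _ _ ((B * (L * r)) ^+ 2)).
      by rewrite ler_pXn2r ?nnegrE // !mulr_ge0.
    have -> : (B * (L * r)) ^+ 2 = L * (2 * B ^+ 2 * (L * (r ^+ 2 / 2))).
      by field.
    have y0 : 0 <= L * (r ^+ 2 / 2) by rewrite !mulr_ge0 // sqr_ge0.
    have z0 : 0 <= 2 * B ^+ 2 * (L * (r ^+ 2 / 2)).
      by rewrite !mulr_ge0 // sqr_ge0.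
    apply: (le_trans (ler_piMl z0 l1)).
    by rewrite ler_wpM2r // /K lerDl.
  have Kx : K * (L' - Linf) <= x * (K - x).
    have K0 : 0 <= K by lra.
    have := ler_wpM2l K0 decr.
    by move: xx; rewrite /x; lra.
  rewrite -[t.+2]addn1 natrD.
  by apply: harmonic_decrease IH Kx => //; lra.
exists (Num.truncn (K / eps)); split.
  by rewrite truncn_le divr_ge0 //; lra.
have [_] := rate (Num.truncn (K / eps)).
have := truncnS_gt (K / eps); rewrite ltr_pdivrMr //.
have := ltr0Sn R (Num.truncn (K / eps)).
move: (_.+1%:R) (state_loss _ _) => n x n0 h1 h2.
rewrite -lerBlDl -(ler_pM2l n0); lra.
Qed.
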